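(* Let $q$ be an odd prime power, write $\mathbb{F}_q=\{0,a_1,\ldots,a_{q-1}\}$ for the finite field with $q$ elements, and let $\chi$ be the quadratic multiplicative character of $\mathbb{F}_q$. Let $$S_q=\left[(a_i^2+a_ia_j+a_j^2)\,\chi(a_i^2+a_ia_j+a_j^2)\right]_{1\le i,j\le q-1},$$ a $(q-1)\times(q-1)$ matrix over $\mathbb{F}_q$. Then there exists an element $u\in\mathbb{F}_q$ such that $$\det S_q=T_{\frac{q+1}{2}}\cdot u^2 \quad\text{in } \mathbb{F}_q,$$ where $T_{\frac{q+1}{2}}$ is the central trinomial coefficient, viewed as an element of $\mathbb{F}_q$.
   Context: The elements $a_1,\ldots,a_{q-1}$ are the nonzero elements of $\mathbb{F}_q$, listed without repetition. The quadratic character $\chi$ is defined by $\chi(0)=0$, $\chi(x)=1$ if $x$ is a nonzero square in $\mathbb{F}_q$, and $\chi(x)=-1$ otherwise; its values $0,\pm1$ are regarded as elements of $\mathbb{F}_q$. For a non-negative integer $n$, the central trinomial coefficient $T_n$ is the coefficient of $x^n$ in $(x^2+x+1)^n\in\mathbb{Z}[x]$, equivalently the constant term of $(x+1+x^{-1})^n$. Integers are viewed in $\mathbb{F}_q$ via the canonical ring homomorphism $\mathbb{Z}\to\mathbb{F}_q$.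
   Formalization: The case q = 3 is excluded, because there the claim fails: over F_3 the matrix S_3 is [[0,1],[1,0]] with determinant −1, while T_2 = 3 = 0 in F_3, so no u exists. *)

(* Defs.v *)
From mathcomp Require Import all_boot all_order all_algebra.

Set Implicit Arguments.
Unset Strict Implicit.
Unset Printing Implicit Defensive.

Import GRing.Theory.
Local Open Scope ring_scope.

Definition central_trinomial (n : nat) : int :=
  (('X^2 + 'X + 1 : {poly int}) ^+ n)`_n.

(* The values 0, 1, -1 are taken in the field itself, not in int. *)
Definition quad_char (F : finFieldType) (x : F) : F :=
  if x == 0 then 0 else if [exists y : F, x == y ^+ 2] then 1 else -1.

(* Over the field with 3 elements, \det (S_mx a) = -1 whereas
   central_trinomial 2 = 3 vanishes; hence q = 3 is excluded in the theorem. *)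
Definition S_mx (F : finFieldType) (n : nat) (a : 'I_n -> F) : 'M[F]_n :=
  \matrix_(i, j)
    ((a i ^+ 2 + a i * a j + a j ^+ 2)
     * quad_char (a i ^+ 2 + a i * a j + a j ^+ 2)).

(* Main.v *)
Require Import Defs.
From mathcomp Require Import all_boot all_order all_algebra.
From mathcomp Require Import cyclic finfield zify ring.

Set Implicit Arguments.
Unset Strict Implicit.
Unset Printing Implicit Defensive.

Import GRing.Theory.
Local Open Scope ring_scope.

(** Put [n = (q + 1) / 2] and let [c_k] be the coefficients of
    [(X^2 + X + 1)^n].  Since [x chi(x) = x^n] by Euler's criterion, the [(i, j)]
    entry is [p(a_i / a_j) a_j^2] with [p = sum_(k <= q + 1) c_k X^k].  On
    [F_q^*] the polynomial [p] may be reduced modulo [X^(q - 1) - 1], with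
    coefficients [d_k = c_k + c_(q - 1 + k)], and a Fourier transform on [F_q^*]
    gives [det = (prod_j a_j)^2 prod_k d_k].  As [c_k = c_(q + 1 - k)], the [d_k]
    pair up into squares, except for [d_n = c_n = T_n] and
    [d_1 = 2 c_1 = 2 n = 1]; in particular [d_0 = d_2]. *)

Lemma sum_unity_root (F : fieldType) (m : nat) (t : F) :
  t ^+ m = 1 -> \sum_(k < m) t ^+ k = m%:R * (t == 1)%:R.
Proof.
move=> tm; have [->|t1] := eqVneq t 1.
  under eq_bigr => k _ do rewrite expr1n.
  by rewrite sumr_const card_ord mulr1.
have /eqP := subrX1 t m; rewrite tm subrr eq_sym mulf_eq0 subr_eq0 (negbTE t1) /=.
by move/eqP->; rewrite mulr0.
Qed.

(** Reduction modulo [X^m - 1]: below degree [2m], each residue class of exponents modulo [m] holds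
    just two coefficients. *)
Lemma horner_unity_root (F : fieldType) (m : nat) (p : {poly F}) (t : F) :
  (size p <= m + m)%N -> t ^+ m = 1 ->
  p.[t] = \sum_(k < m) (p`_k + p`_(m + k)) * t ^+ k.
Proof.
move=> sp tm; rewrite (horner_coef_wide _ sp) big_split_ord /= -big_split /=.
by apply: eq_bigr => k _; rewrite exprD tm mul1r mulrDl.
Qed.

(** The matrix factors as [V D W], with [V] and [W] Vandermonde in the [a_i] and in their inverses.
    Orthogonality of the powers gives [V W = m I], so only the product of [det V] and [det W] is
    ever needed. *)
Lemma det_horner_unity_roots (F : fieldType) (m : nat) (a : 'I_m -> F)
    (p : {poly F}) :
  injective a -> (forall i, a i ^+ m = 1) -> (size p <= m + m)%N ->
  \det (\matrix_(i, j) p.[a i / a j]) =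
    m%:R ^+ m * \prod_(k < m) (p`_k + p`_(m + k)).
Proof.
move=> a_inj am sp.
pose V : 'M[F]_m := \matrix_(i, k) a i ^+ k.
pose W : 'M[F]_m := \matrix_(k, j) (a j)^-1 ^+ k.
pose D : 'rV[F]_m := \row_k (p`_k + p`_(m + k)).
have divm i j : (a i / a j) ^+ m = 1 by rewrite exprMn exprVn !am invr1 mulr1.
have -> : \matrix_(i, j) p.[a i / a j] = V *m diag_mx D *m W.
  apply/matrixP=> i j; rewrite mul_mx_diag !mxE (horner_unity_root sp (divm i j)).
  by apply: eq_bigr => k _; rewrite !mxE exprMn; ring.
have VW : V *m W = (m%:R)%:M.
  apply/matrixP=> i j; rewrite !mxE.
  under eq_bigr => k _ do rewrite !mxE -exprMn.
  rewrite sum_unity_root // -[RHS]mulr_natr; congr (_ * _%:R).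
  have aj0 : a j != 0.
    have m_gt0 : (0 < m)%N by apply: leq_ltn_trans (ltn_ord j).
    by apply: contra_eq_neq (am j) => ->; rewrite expr0n gtn_eqF // eq_sym oner_eq0.
  by rewrite -(inj_eq (mulIf aj0)) mulfVK // mul1r (inj_eq a_inj).
rewrite !det_mulmx mulrAC -det_mulmx VW det_scalar det_diag.
by congr (_ * _); apply: eq_bigr => k _; rewrite mxE.
Qed.

Section TrinomialPowers.

Variable R : comNzRingType.

Let T (n : nat) : {poly R} := ('X^2 + 'X + 1) ^+ n.

Let coef_TS n k :
  (T n.+1)`_k = (if (k < 2)%N then 0 else (T n)`_(k - 2)) +
                (if k == 0 then 0 else (T n)`_k.-1) + (T n)`_k.
Proof. by rewrite /T exprSr !mulrDr mulr1 !coefD coefMXn coefMX. Qed.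

Lemma size_trinomialX n : (size (T n) <= n.*2.+1)%N.
Proof.
apply: leq_trans (size_poly_exp_leq _ _) _; rewrite ltnS -mul2n leq_mul2r.
have : (size ('X^2 + 'X + 1 : {poly R})%R <= 3)%N.
  by apply/leq_sizeP => -[|[|[|j]]] // _; rewrite !coefD coefXn coefX coef1 !addr0.
by case: size => [|s] /=; lia.
Qed.

Lemma coef_trinomialX_sym n i j : (i + j)%N = n.*2 -> (T n)`_i = (T n)`_j.
Proof.
elim: n i j => [|n IHn] i j; first by case: i j => [|i] [|j].
have big0 k : (n.*2 < k)%N -> (T n)`_k = 0.
  by move=> nk; rewrite nth_default // (leq_trans (size_trinomialX n)).
wlog ij : i j / (i <= j)%N.
  by move=> W e; case: (leqP i j) => [/W->//|/ltnW/W->//]; rewrite addnC.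
(* For [i = 0] and [i = 1] the recurrence lacks its lower terms; on the side of [j] the matching
   terms lie beyond degree [2n] and vanish by [big0]. *)
case: i ij => [|[|i]] ij e; rewrite !coef_TS.
- have -> : j = n.*2.+2 by lia.
  by rewrite /= subn2 /= !(big0 n.*2.+1) ?(big0 n.*2.+2) // (IHn 0 n.*2) //; ring.
- have -> : j = n.*2.+1 by lia.
  case: n {e ij} IHn big0 => [|n] IHn big0; first by [].
  rewrite /= subn2 /= (big0 n.+1.*2.+1) // (IHn 0 n.+1.*2) //.
  by rewrite (IHn 1 n.*2.+1) //; ring.
- case: j ij e => [|[|j]] // ij e; rewrite /= !subn2 /=.
  rewrite (IHn i j.+2) 1?(IHn i.+1 j.+1) 1?(IHn i.+2 j); try lia.
  by ring.
Qed.

Lemma coef_trinomialX0 n : (T n)`_0 = 1.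
Proof. by elim: n => [|n IHn]; rewrite ?coef_TS /= ?IHn ?add0r // /T expr0 coef1. Qed.

Lemma coef_trinomialX1 n : (T n)`_1 = n%:R.
Proof.
elim: n => [|n IHn]; first by rewrite /T expr0 coef1.
by rewrite coef_TS /= IHn coef_trinomialX0 add0r -natr1 addrC.
Qed.

End TrinomialPowers.

Section FiniteField.

Variable F : finFieldType.

(** Translation by 1 permutes [F] but adds [#|F|] to the sum of all elements. *)
Lemma natr_card_finField : #|F|%:R = 0 :> F.
Proof.
have : \sum_(x : F) x = \sum_(x : F) (x + 1) by apply/reindex_inj/addIr.
rewrite big_split /= sumr_const => /eqP.
by rewrite addrC -subr_eq subrr eq_sym => /eqP.
Qed.

Lemma expf_card_pred (x : F) : x != 0 -> x ^+ #|F|.-1 = 1.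
Proof.
move=> x0; apply: (mulfI x0); rewrite -exprS mulr1 prednK ?expf_card //.
exact: ltnW (finNzRing_gt1 F).
Qed.

Lemma quad_charE (x : F) : odd #|F| -> x != 0 -> quad_char x = x ^+ #|F|.-1./2.
Proof.
move=> oddF x0; set h := _./2.
have F_gt1 : (1 < #|F|)%N by apply: finNzRing_gt1.
have card1E : #|F|.-1 = h.*2 by rewrite /h; lia.
have h_gt0 : (0 < h)%N by lia.
rewrite /quad_char (negbTE x0).
case: existsP => [[y /eqP xE]|nsq].
  by rewrite xE -exprM mul2n -card1E expf_card_pred // -sqrf_eq0 -xE.
have /eqP : (x ^+ h) ^+ 2 = 1 by rewrite -exprM muln2 -card1E expf_card_pred.
rewrite sqrf_eq1 => /orP[/eqP xh1|/eqP-> //]; case: nsq.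
(* Take a generator [z] of the multiplicative group and write [x = z^i]. Then [x^h = 1] forces [2h]
   to divide [i h], so [i] is even and [x] is a square. *)
have /hasP[z _ z_prim] : has #|F|.-1.-primitive_root (enum (predC1 (0 : F))).
  apply: has_prim_root; rewrite ?enum_uniq -?cardE ?cardC1 //; first by lia.
  by apply/allP => y; rewrite mem_enum unity_rootE => /expf_card_pred->.
have [[i _] /= xE] := prim_rootP z_prim (expf_card_pred x0).
have := prim_order_dvd z_prim (i * h).
rewrite exprM -xE xh1 eqxx card1E -mul2n dvdn_pmul2r // => /dvdnP[k iE].
by exists (z ^+ k); rewrite xE iE exprM.
Qed.

Lemma mul_quad_char (x : F) : odd #|F| -> x * quad_char x = x ^+ (#|F|.+1 %/ 2).
Proof.
move=> oddF; have -> : (#|F|.+1 %/ 2 = (#|F|.-1./2).+1)%N.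
  by have F_gt1 : (1 < #|F|)%N := finNzRing_gt1 F; lia.
have [->|x0] := eqVneq x 0; first by rewrite mul0r exprS mul0r.
by rewrite quad_charE // exprS.
Qed.

End FiniteField.

(** The range [3, ..., 2n - 3] is symmetric about [n], so [k] pairs with [2n - k] and only [n] is
    its own partner. *)
Lemma prod_palindrome (R : comNzRingType) (d : nat -> R) (n : nat) :
  (3 <= n)%N ->
  (forall i j, (3 <= i)%N -> (3 <= j)%N -> (i + j)%N = n.*2 -> d i = d j) ->
  \prod_(k < n.*2 - 2) d k =
    d 0%N * d 1%N * d 2%N * d n * (\prod_(3 <= k < n) d k) ^+ 2.
Proof.
move=> n3 dsym; rewrite -(big_mkord xpredT d).
rewrite (big_cat_nat (n := 3)) /=; [|lia|lia].
rewrite (big_cat_nat (n := n) (m := 3)) /=; [|lia|lia].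
rewrite (big_ltn (m := n)); last by lia.
have -> : \prod_(n.+1 <= k < n.*2 - 2) d k = \prod_(3 <= k < n) d k.
  have shift f : \prod_(n.+1 <= k < n.*2 - 2) f k =
                 \prod_(3 <= k < n) f (k + (n - 2))%N :> R.
    rewrite (_ : n.+1 = 3 + (n - 2))%N; last by lia.
    by rewrite big_addn (_ : n.*2 - 2 - (n - 2) = n)%N //; lia.
  (* Reversing and then shifting by [n - 2] turns the factor at [k] into [d (2n - k)]. *)
  rewrite big_nat_rev shift big_nat_cond [RHS]big_nat_cond.
  by apply: eq_bigr => k; rewrite andbT => kb; apply: dsym; lia.
rewrite !big_nat_recr //= big_geq //.
by ring.
Qed.

Theorem theorem1p1 (F : finFieldType) (q : nat)
    (card_F : #|F| = q) (odd_q : odd q) (q_neq3 : q <> 3%N)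
    (a : 'I_q.-1 -> F) (a_inj : injective a)
    (a_codom : forall x : F, x != 0 <-> exists i : 'I_q.-1, a i = x) :
  exists u : F,
    \det (S_mx a) = (central_trinomial (q.+1 %/ 2))%:~R * u ^+ 2.
Proof.
set n := (q.+1 %/ 2)%N.
have q_gt1 : (1 < q)%N by rewrite -card_F finNzRing_gt1.
have mE : q.-1 = (n.*2 - 2)%N by rewrite /n; lia.
(* Here [q <> 3] enters: it keeps the central index [n] away from the indices 0, 1, 2 that folding
   alters. *)
have n3 : (3 <= n)%N by rewrite /n; lia.
have a0 i : a i != 0 by apply/a_codom; exists i.
have am i : a i ^+ q.-1 = 1 by rewrite -card_F expf_card_pred.
pose p : {poly F} := ('X^2 + 'X + 1) ^+ n.
pose d k := p`_k + p`_(q.-1 + k).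
have q0 : q%:R = 0 :> F by rewrite -card_F natr_card_finField.
have m1 : (q.-1)%:R = -1 :> F.
  by apply/eqP; rewrite -addr_eq0 natr1 prednK ?q0 //; lia.
have nn1 : n%:R + n%:R = 1 :> F.
  by rewrite -natrD (_ : n + n = q.+1)%N -?natr1 ?q0 ?add0r // /n; lia.
have p0 k : (n.*2 < k)%N -> p`_k = 0.
  by move=> nk; rewrite nth_default // (leq_trans (size_trinomialX F n)).
have d0 : d 0%N = d 2%N.
  rewrite /d (coef_trinomialX_sym F (n := n) (i := 2) (j := q.-1 + 0)); last by lia.
  rewrite (coef_trinomialX_sym F (n := n) (i := 0) (j := q.-1 + 2)); last by lia.
  by rewrite addrC.
have d1 : d 1%N = 1.
  rewrite /d -(coef_trinomialX_sym F (n := n) (i := 1) (j := q.-1 + 1)); last by lia.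
  by rewrite coef_trinomialX1.
(* Since [p] has degree at most [2n = (q - 1) + 2], folding adds nothing from [k = 3] on. *)
have dE k : (3 <= k)%N -> d k = p`_k by move=> k3; rewrite /d (p0 (q.-1 + k)%N) ?addr0 //; lia.
have dn : d n = (central_trinomial n)%:~R.
  rewrite dE // /central_trinomial -(coef_map (intmul 1)).
  by rewrite rmorphXn /= !rmorphD /= map_polyXn map_polyX rmorph1.
have dsym i j : (3 <= i)%N -> (3 <= j)%N -> (i + j)%N = n.*2 -> d i = d j.
  by move=> i3 j3 ij; rewrite !dE // (coef_trinomialX_sym F ij).
have entry i j : S_mx a i j = p.[a i / a j] * a j ^+ 2.
  rewrite mxE mul_quad_char card_F // -/n /p horner_exp !hornerD hornerXn hornerX hornerC.
  (* The exponent is [2n = (q - 1) + 2]; so pulling [a_j^2] out of the quadratic form before taking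
     the [n]-th power leaves a factor [a_j^2]. *)
  have ajn : (a j ^+ 2) ^+ n = a j ^+ 2.
    by rewrite -exprM mul2n (_ : n.*2 = q.-1 + 2)%N ?exprD ?am ?mul1r //; lia.
  by rewrite -[X in _ = _ * X]ajn -exprMn; congr (_ ^+ n); field.
have -> : S_mx a =
    \matrix_(i, j) p.[a i / a j] *m diag_mx (\row_j a j ^+ 2).
  by apply/matrixP => i j; rewrite mul_mx_diag entry !mxE.
rewrite det_mulmx det_diag det_horner_unity_roots //; last first.
  by rewrite (leq_trans (size_trinomialX F n)) //; lia.
rewrite m1 -signr_odd (_ : odd q.-1 = false) ?expr0 ?mul1r; last by lia.
have -> : \prod_(k < q.-1) (p`_k + p`_(q.-1 + k)) = \prod_(k < n.*2 - 2) d k.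
  by rewrite -mE.
rewrite (prod_palindrome n3 dsym) d0 d1 dn.
(* The three factors come from [d_0 d_2 = d_2^2], from the pairs around [n], and from the column
   scaling by [a_j^2]. *)
exists (d 2%N * (\prod_(3 <= k < n) d k) * \prod_j a j).
have -> : \prod_i (\row_j a j ^+ 2) 0 i = (\prod_j a j) ^+ 2.
  by rewrite -prodrXl; apply: eq_bigr => j _; rewrite mxE.
by ring.
Qed.
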